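(* Let $O$ be a finite set with at least two elements and let $(G_\theta)_{\theta\in(0,\infty)}$ be a family of probability densities on $(0,\infty)$. Assume that for every $x\in(0,\infty)$ the maximum likelihood estimate $\hat\theta(x)=\arg\max_{\theta\in(0,\infty)}G_\theta(x)$ of $\theta$ given one measurement $x$ exists and is well defined (unique), and put $g(x)=G_{\hat\theta(x)}(x)$. Let $x=(x_e)_{e\in\binom{O}{2}}$ be a measurement, $x_e\in(0,\infty)$. Let $\bar u=(\bar\tau,\bar a)=\mathfrak{sl}(x)$ be the single linkage ultra-metric of $x$, and let $\hat u=(\hat\tau,\hat a)$ be the maximum partial profile likelihood estimate, i.e. the maximizer over strict ultra-metrics $u$ on $O$ of $$\mathcal L_{pp}(u;x)=\max_{T\in\mathrm{MST}(u)}\ \prod_{e\in T}G_{u_e}(x_e).$$ Then: 1. If $\hat\theta$ is strictly increasing and $g$ is strictly decreasing, then $\bar\tau=\hat\tau$. 2. If, in addition, $\hat\theta(x)=x$ holds for all $x\in(0,\infty)$, then $\bar u=\hat u$.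
   Context: $\binom{O}{2}$ is the set of unordered pairs (edges) $e=xy$, $x\ne y$, of the complete graph $K_O$ on $O$. A weight on $O$ is a symmetric function $d:O\times O\to[0,\infty)$ with $d(x,x)=0$, written $d_{xy}$ or $d_e$; it is strict if $d_{xy}>0$ for $x\neq y$. An ultra-metric is a weight with $u_{xz}\le\max\{u_{xy},u_{yz}\}$ for all $x,y,z$. $\mathrm{MST}(d)$ is the set of spanning trees $T$ of $K_O$ (identified with their edge sets) that minimize $\sum_{e\in T}d_e$. For a weight $d$, the single linkage ultra-metric $\mathfrak{sl}(d)$ is given by: $\mathfrak{sl}(d)_{xy}$ is the least $r\ge 0$ such that there are points $x=x_0,x_1,\dots,x_m=y$ in $O$ with $d(x_{i-1},x_i)\le r$ for all $i$; equivalently $\mathfrak{sl}(d)_{xy}=\sup\{u_{xy}: u \text{ an ultra-metric on } O,\ u\le d\}$. An ultra-metric $u$ defines partitions $\beta_u(r)$, $r\ge0$, where the cluster of $x$ in $\beta_u(r)$ is $\{y\in O: u_{xy}\le r\}$. We write $u=(\tau,a)$, where the structure $\tau$ of $u$ is the chain of partitions $\{\beta_u(r): r\ge 0\}$ ordered by refinement (with the resolutions $r$ forgotten), and $a$ is the height vector listing, in order, the minimal $r$ at which each partition in the chain occurs. *)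

(* Defs.v *)
From HB Require Import structures.
From mathcomp Require Import all_boot all_order all_algebra.
From mathcomp Require Import all_classical all_reals all_analysis.

Set Implicit Arguments.
Unset Strict Implicit.
Unset Printing Implicit Defensive.

Import Order.TTheory GRing.Theory Num.Theory.
Import numFieldNormedType.Exports.

Local Open Scope classical_set_scope.
Local Open Scope ring_scope.

Definition is_density (R : realType) (f : R -> R) : Prop :=
  [/\ measurable_fun (`]0, +oo[ : set R) f,
      forall t, 0 < t -> 0 <= f t &
      (\int[lebesgue_measure]_(t in `]0%R, +oo[) (f t)%:E = 1)%E].

Definition is_mle (R : realType) (G : R -> R -> R) (t theta : R) : Prop :=
  0 < theta /\ forall theta', 0 < theta' -> G theta' t <= G theta t.

Definition is_weight (R : realType) (O : finType) (d : O -> O -> R) : Prop :=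
  [/\ forall x y, d x y = d y x,
      forall x, d x x = 0 &
      forall x y, 0 <= d x y].

Definition is_strict (R : realType) (O : finType) (d : O -> O -> R) : Prop :=
  forall x y, x != y -> 0 < d x y.

Definition is_ultrametric (R : realType) (O : finType) (u : O -> O -> R) : Prop :=
  is_weight u /\ forall x y z, u x z <= Num.max (u x y) (u y z).

Definition is_edge (O : finType) (e : {set O}) : bool := #|e| == 2%N.

(* The value d x y for e = {x, y}; by symmetry of d it does not depend on which
   of the two orderings of e is picked. *)
Definition edge_weight (R : realType) (O : finType) (d : O -> O -> R)
    (e : {set O}) : R :=
  if [pick p : O * O | (p.1 != p.2) && (e == [set p.1; p.2]%SET)] is Some p
  then d p.1 p.2 else 0.

Definition adj (O : finType) (T : {set {set O}}) : rel O :=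
  fun x y => [set x; y]%SET \in T.

(* Since [adj T] is symmetric, a single edge {x, y} gives the [ucycle]
   [:: x; y]; genuine cycles have at least three vertices. *)
Definition is_spanning_tree (O : finType) (T : {set {set O}}) : Prop :=
  [/\ forall e, e \in T -> is_edge e,
      forall x y, connect (adj T) x y &
      forall c : seq O, (2 < size c)%N -> ~ ucycle (adj T) c].

Definition tree_length (R : realType) (O : finType) (d : O -> O -> R)
    (T : {set {set O}}) : R :=
  \sum_(e in T) edge_weight d e.

Definition MST (R : realType) (O : finType) (d : O -> O -> R) :
    set {set {set O}} :=
  [set T | is_spanning_tree T /\
     forall T', is_spanning_tree T' -> tree_length d T <= tree_length d T'].

Definition chained (R : realType) (O : finType) (d : O -> O -> R)
    (x y : O) (r : R) : Prop :=
  0 <= r /\ exists2 p : seq O, path (fun a b => d a b <= r) x p & last x p = y.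

(* The infimum is attained, see [sl_least]. *)
Definition sl (R : realType) (O : finType) (d : O -> O -> R) (x y : O) : R :=
  inf [set r | chained d x y r].

Lemma sl_least (R : realType) (O : finType) (d : O -> O -> R) (x y : O) :
  is_weight d ->
  chained d x y (sl d x y) /\ forall r, chained d x y r -> sl d x y <= r.
Proof.
case=> _ dxx d0.
pose D r := [rel a b : O | d a b <= r].
have chD r : chained d x y r <-> 0 <= r /\ connect (D r) x y.
  split; case=> r0; first by case=> p Hp <-; split=> //; apply/connectP; exists p.
  by case/connectP=> p Hp ->; split=> //; exists p.
have chxy : connect (D (d (x, y).1 (x, y).2)) x y by apply: connect1 => /=.
case: (@arg_minP _ R _ (x, y)
  (fun q : O * O => connect (D (d q.1 q.2)) x y) (fun q => d q.1 q.2) chxy).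
move=> q qxy qmin.
have chq : chained d x y (d q.1 q.2) by apply/chD.
have lbq r : chained d x y r -> d q.1 q.2 <= r.
  move=> /chD [r0 /connectP [p Hp yE]].
  have d00 : d (x, x).1 (x, x).2 <= r by rewrite /= dxx.
  case: (@arg_maxP _ R _ (x, x) (fun s : O * O => d s.1 s.2 <= r)
    (fun s => d s.1 s.2) d00) => s sr smax.
  apply: le_trans sr; apply: qmin; apply/connectP; exists p => //.
  by apply: sub_path Hp => a b /= abr; exact: (smax (a, b)).
suff -> : sl d x y = d q.1 q.2 by [].
apply/eqP; rewrite eq_le; apply/andP; split.
  by apply: ge_inf => //; exists 0 => r [].
by apply: lb_le_inf; [exists (d q.1 q.2) | move=> r /lbq].
Qed.

Definition beta (R : realType) (O : finType) (u : O -> O -> R) (r : R) :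
    {set {set O}} :=
  [set [set y | u x y <= r]%SET | x : O]%SET.

(* A family of partitions that is a chain for refinement is determined, order
   included, by its underlying set. *)
Definition structure (R : realType) (O : finType) (u : O -> O -> R) :
    set {set {set O}} :=
  [set beta u r | r in [set r | 0 <= r]].

(* The products are nonnegative when every G theta is a density, so the
   default value 0 of the iterated maximum is harmless. *)
Definition pp_likelihood (R : realType) (O : finType) (G : R -> R -> R)
    (u x : O -> O -> R) : R :=
  \big[Num.max/0]_(T : {set {set O}} | `[< MST u T >])
    \prod_(e in T) G (edge_weight u e) (edge_weight x e).

Definition is_mpple (R : realType) (O : finType) (G : R -> R -> R)
    (x uhat : O -> O -> R) : Prop :=
  [/\ is_ultrametric uhat, is_strict uhat &
      forall u, is_ultrametric u -> is_strict u ->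
        pp_likelihood G u x <= pp_likelihood G uhat x].

(* Main.v *)
(* Minimality of a spanning tree T depends only on the order of the edge costs:
T is minimal iff any two points p, q are joined in T by edges that cost at most
c(pq). As g is positive and strictly decreasing, the trees maximizing
prod_(e in T) g(x_e), i.e. minimizing the sum of the costs - ln g(x_e), are
therefore the minimum spanning trees M of x, and prod_(e in M) g(x_e) bounds the
partial profile likelihood. As thetahat is increasing, M is also minimal for
thetahat o sl(x), which equals thetahat(x_e) on the edges of M, so the bound is
attained there. Conversely, if u attains it, some tree is minimal for both u and
x and carries u_e = thetahat(x_e); an ultra-metric is determined by its values
on a minimum spanning tree, so u = thetahat o sl(x) off the diagonal. *)
Require Import Defs.
From HB Require Import structures.
From mathcomp Require Import all_boot all_order all_algebra.
From mathcomp Require Import all_classical all_reals all_analysis.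

Set Implicit Arguments.
Unset Strict Implicit.
Unset Printing Implicit Defensive.

Import Order.TTheory GRing.Theory Num.Theory.
Import numFieldNormedType.Exports.

Local Open Scope ring_scope.

(** * Edges as two-element sets *)

Lemma set2_inj (O : finType) (a b p q : O) :
  [set p; q]%SET = [set a; b]%SET -> (p = a /\ q = b) \/ (p = b /\ q = a).
Proof.
move=> E.
have : p \in [set a; b]%SET by rewrite -E set21.
have : q \in [set a; b]%SET by rewrite -E set22.
have : a \in [set p; q]%SET by rewrite E set21.
have : b \in [set p; q]%SET by rewrite E set22.
rewrite !inE => bpq apq /orP[] /eqP qE /orP[] /eqP pE; move: bpq apq; rewrite qE pE.
- by case/orP=> /eqP -> _; left.
- by right.
- by left.
- by move=> _ /orP[] /eqP ->; left.
Qed.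

Lemma is_edge_set2 (O : finType) (p q : O) : is_edge [set p; q]%SET = (p != q).
Proof. by rewrite /is_edge cards2; case: (p != q). Qed.

Lemma edge_weight_set2 (R : realType) (O : finType) (d : O -> O -> R) (p q : O) :
  is_weight d -> p != q -> edge_weight d [set p; q]%SET = d p q.
Proof.
case=> dC _ _ pq; rewrite /edge_weight; case: pickP => [[a b] /=|/(_ (p, q))].
  by case/andP=> _ /eqP/set2_inj[[-> ->]|[-> ->]].
by rewrite /= pq eqxx.
Qed.

(** * Connectivity in edge sets, and spanning trees *)

Lemma adjC (O : finType) (F : {set {set O}}) : symmetric (adj F).
Proof. by move=> p q; rewrite /adj finset.setUC. Qed.

Lemma connect_adjC (O : finType) (F : {set {set O}}) : connect_sym (adj F).
Proof. exact/sym_connect_sym/adjC. Qed.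

Lemma connect_adjS (O : finType) (F F' : {set {set O}}) (p q : O) :
  F \subset F' -> connect (adj F) p q -> connect (adj F') p q.
Proof.
by move=> /fintype.subsetP sFF'; apply: connect_sub => a b /sFF'; exact: connect1.
Qed.

(** A walk that crosses the edge [ab] several times can be shortened, so at most one crossing, in
    one of the two directions, need be kept. *)
Lemma connect_adjU1 (O : finType) (F : {set {set O}}) (a b p q : O) :
  connect (adj ([set a; b] |: F)%SET) p q ->
  [\/ connect (adj F) p q,
      connect (adj F) p a /\ connect (adj F) b q |
      connect (adj F) p b /\ connect (adj F) a q].
Proof.
case/connectP=> s; elim: s p => [|z s IH] p /=.
  by move=> _ ->; constructor 1.
case/andP; rewrite {1}/adj 2!inE => pz zs qE.
have {IH}:= IH _ zs qE; case/orP: pz => [/eqP/set2_inj[[-> ->]|[-> ->]]|pz].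
- by case=> [?|[_ ?]|[_ ?]]; [constructor 2|constructor 2|constructor 1].
- by case=> [?|[_ ?]|[_ ?]]; [constructor 3|constructor 1|constructor 3].
have pz' : connect (adj F) p z := connect1 pz.
by case=> [zq|[za bq]|[zb aq]];
  [constructor 1|constructor 2; split=> //|constructor 3; split=> //];
  apply: connect_trans pz' _.
Qed.

(** Acyclicity becomes the condition that every edge is a bridge, the form suited to exchange
    arguments. A simple path avoiding an edge but joining its ends closes up to a cycle, and
    conversely. *)
Lemma spanning_treeP (O : finType) (T : {set {set O}}) :
  is_spanning_tree T <->
  [/\ forall e, e \in T -> is_edge e, forall p q, connect (adj T) p q &
      forall a b, [set a; b]%SET \in T ->
        ~~ connect (adj (T :\ [set a; b])%SET) a b].
Proof.
split=> -[Te Tc Ta]; split=> //.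
  move=> a b abT; apply/negP => /connectP[s sP bE].
  have ab : a != b by rewrite -is_edge_set2 Te.
  case/shortenP: sP bE => s' s'P us' _ bE.
  have sT : path (adj T) a s'.
    by apply: sub_path s'P => u v; rewrite /adj in_setD1 => /andP[].
  apply: (Ta (a :: s')); last first.
    by rewrite /ucycle us' /= rcons_path sT /= -bE adjC /adj abT.
  (* A path with no step would give [a = b], and one with a single step would use the removed edge,
     so the closed path has at least three vertices. *)
  case: s' bE s'P {us' sT} => [/= bE|z [|//] /= ->]; first by rewrite bE eqxx in ab.
  by rewrite /adj in_setD1 eqxx.
move=> [|x [|y [|z s]]] // _ /andP[/= /and3P[xy yz]].
rewrite rcons_path => /andP[zs lx] /andP[xn /andP[yn _]].
have /negP[] := Ta _ _ xy; rewrite connect_adjC.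
have xin u v : u != x -> v != x -> ([set u; v] != [set x; y])%SET.
  move=> ux vx; apply/eqP => /set2_inj[[ux' _]|[_ vx']].
    by rewrite ux' eqxx in ux.
  by rewrite vx' eqxx in vx.
have yx : y != x by apply: contraNneq xn => ->; rewrite inE eqxx.
have nx v : v \in z :: s -> v != x.
  by move=> vs; apply: contraNneq xn => <-; rewrite inE vs orbT.
(* The cycle without its edge [xy] leads from [y] back to [x]: only the last step touches [x], and
   that step does not start at [y]. *)
apply: (@connect_trans _ _ (last z s)).
  apply/connectP; exists (z :: s) => //=; apply/andP; split.
    by rewrite /adj in_setD1 xin // nx // inE eqxx.
  apply: (sub_in_path (P := mem (z :: s)) (e := adj T) _ _ zs); last exact/allP.
  by move=> u v us vs uv; rewrite /adj in_setD1 xin ?nx.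
apply: connect1; rewrite /adj in lx *; rewrite in_setD1 lx andbT.
apply/eqP => /set2_inj[[lz _]|[ly _]].
  by have := nx (last z s) (mem_last _ _); rewrite lz eqxx.
by move: yn; rewrite -ly mem_last.
Qed.

(** Removing [f] leaves two components; [a] and [b] lie in different ones, and the new edge joins
    them again. *)
Lemma spanning_tree_exchange (O : finType) (T : {set {set O}}) f (a b : O) :
  is_spanning_tree T -> f \in T -> ~~ connect (adj (T :\ f)%SET) a b ->
  is_spanning_tree ([set a; b] |: (T :\ f))%SET.
Proof.
move=> /spanning_treeP[Te Tc Ta] fT nab; apply/spanning_treeP.
have ab : a != b by apply: contraNneq nab => ->.
have sT' : (T :\ f \subset [set a; b] |: (T :\ f))%SET by exact: finset.subsetUr.
have abT' : connect (adj ([set a; b] |: (T :\ f))%SET) a b.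
  by apply: connect1; rewrite /adj setU11.
split.
- move=> e; rewrite 2!inE => /orP[/eqP->|]; first by rewrite is_edge_set2.
  by rewrite in_setD1 => /andP[_ /Te].
- have /cards2P[u [v [_ fE]]] := Te _ fT.
  have cut p q : connect (adj T) p q ->
      [\/ connect (adj (T :\ f)%SET) p q,
          connect (adj (T :\ f)%SET) p u /\ connect (adj (T :\ f)%SET) v q |
          connect (adj (T :\ f)%SET) p v /\ connect (adj (T :\ f)%SET) u q].
    by rewrite -{1}(finset.setD1K fT) {1}fE => /connect_adjU1.
  (* The removed edge [f], with ends [u] and [v], is replaced by a detour through [ab]. *)
  have uv : connect (adj ([set a; b] |: (T :\ f))%SET) u v.
    case: (cut _ _ (Tc a b)) => [ab'|[au vb]|[av ub]].
    + by rewrite ab' in nab.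
    + rewrite connect_adjC in au; rewrite connect_adjC in vb.
      apply: connect_trans (connect_adjS sT' au) _.
      by apply: connect_trans abT' (connect_adjS sT' vb).
    + rewrite connect_adjC in abT'.
      apply: connect_trans (connect_adjS sT' ub) _.
      by apply: connect_trans abT' (connect_adjS sT' av).
  move=> p q; case: (cut _ _ (Tc p q)) => [|[pu vq]|[pv uq]].
  + exact: connect_adjS.
  + apply: connect_trans (connect_adjS sT' pu) _.
    by apply: connect_trans uv (connect_adjS sT' vq).
  + apply: connect_trans (connect_adjS sT' pv) _.
    rewrite connect_adjC in uv.
    by apply: connect_trans uv (connect_adjS sT' uq).
- have abT : ([set a; b] \notin T :\ f)%SET.
    by apply: contra nab => abT; exact: connect1.
  move=> p q; rewrite 2!inE => /orP[/eqP pq|].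
    rewrite pq finset.setU1K //.
    by case: (set2_inj pq) => -[-> ->] //; rewrite connect_adjC.
  move=> pqT; have /setD1P[pqf pqT'] := pqT.
  have pqn := Ta _ _ pqT'.
  set h := [set p; q]%SET in pqT pqf pqT' pqn *.
  apply/negP => pq.
  have s1 : (([set a; b] |: (T :\ f)) :\ h \subset [set a; b] |: (T :\ f :\ h))%SET.
    by apply/fintype.subsetP => e; rewrite !inE; case: (e == h) => //=.
  have s2 : (T :\ f :\ h \subset T :\ h)%SET.
    by apply/fintype.subsetP => e; rewrite !inE => /and3P[-> _ ->].
  have s3 : (T :\ f :\ h \subset T :\ f)%SET by exact: finset.subD1set.
  have cpq : connect (adj (T :\ f)%SET) p q by exact: connect1.
  (* A path from [p] to [q] without the edge [pq] must cross [ab]; its two remaining pieces and [pq]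
     would join [a] to [b] in [T :\ f]. *)
  case: (connect_adjU1 (connect_adjS s1 pq)) => [/(connect_adjS s2)|[pa bq]|[pb aq]].
  + exact/negP.
  + case/negP: nab; have pa' := connect_adjS s3 pa; have bq' := connect_adjS s3 bq.
    rewrite connect_adjC in pa'; rewrite connect_adjC in bq'.
    exact: connect_trans pa' (connect_trans cpq bq').
  + case/negP: nab; have pb' := connect_adjS s3 pb; have aq' := connect_adjS s3 aq.
    rewrite connect_adjC in cpq.
    exact: connect_trans aq' (connect_trans cpq pb').
Qed.

(** A minimal connected set of edges is a tree: an edge that is not a bridge could be dropped. *)
Lemma spanning_tree_exists (O : finType) :
  exists T : {set {set O}}, is_spanning_tree T.
Proof.
pose P (F : {set {set O}}) := [forall p, forall q, connect (adj F) p q].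
pose Q (F : {set {set O}}) := [forall e in F, is_edge e] && P F.
have Q0 : Q [set e | is_edge e]%SET.
  apply/andP; split; first by apply/forall_inP => e; rewrite inE.
  apply/forallP => p; apply/forallP => q.
  case: (eqVneq p q) => [->//|pq]; apply: connect1.
  by rewrite /adj inE is_edge_set2.
have [T /minsetP[/andP[/forall_inP Te /forallP TP] Tmin] _] := minset_exists Q0.
have Tc p q : connect (adj T) p q by have /forallP := TP p.
exists T; apply/spanning_treeP; split=> // a b abT; apply/negP => ab.
have : (T :\ [set a; b])%SET = T.
  apply: Tmin; last exact: finset.subD1set.
  apply/andP; split; first by apply/forall_inP => e /setD1P[_ /Te].
  apply/forallP => p; apply/forallP => q.
  have := Tc p q; rewrite -{1}(finset.setD1K abT) => /connect_adjU1[//|[pa bq]|[pb aq]].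
    exact: connect_trans pa (connect_trans ab bq).
  by rewrite connect_adjC in ab; exact: connect_trans pb (connect_trans ab aq).
by move=> /setP/(_ [set a; b]%SET); rewrite abT in_setD1 eqxx.
Qed.

(** * Minimum spanning trees and the bottleneck property *)

Definition cost (R : realType) (O : finType) (c : {set O} -> R)
  (T : {set {set O}}) : R := \sum_(e in T) c e.

(** For [edge_weight d] this unfolds to [MST d]. Arbitrary real costs are allowed because negative
    logarithms of likelihoods can be negative. *)
Definition min_spanning_tree (R : realType) (O : finType) (c : {set O} -> R)
    (T : {set {set O}}) : Prop :=
  is_spanning_tree T /\ forall T', is_spanning_tree T' -> cost c T <= cost c T'.

(* Order-theoretic form of minimality; only comparisons of costs occur, so it
transfers along monotone changes of the costs. *)
Definition bottleneck (R : realType) (O : finType) (c : {set O} -> R)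
    (T : {set {set O}}) : Prop :=
  forall p q, p != q ->
    connect (adj [set e in T | c e <= c [set p; q]]%SET) p q.

Lemma cost_exchange (R : realType) (O : finType) (c : {set O} -> R)
    (T : {set {set O}}) e f :
  f \in T -> e \notin (T :\ f)%SET ->
  cost c (e |: (T :\ f))%SET = cost c T + c e - c f.
Proof.
move=> fT eT; rewrite /cost big_setU1 //= [in RHS](big_setD1 f) //=.
by rewrite [c f + _]addrC addrAC addrK addrC.
Qed.

(** The path of [T] from [p] to [q] has an edge outside [L], and each of its edges separates [p]
    from [q]. A minimal set [S] between [L] and [T] joining [p] and [q] stands in for [L] together
    with that path. *)
Lemma exists_separating_edge (O : finType) (T L : {set {set O}}) (p q : O) :
  is_spanning_tree T -> L \subset T -> ~~ connect (adj L) p q ->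
  exists e, [/\ e \in T, e \notin L & ~~ connect (adj (T :\ e)%SET) p q].
Proof.
move=> /spanning_treeP[Te Tc Ta] LT nL.
pose P (S : {set {set O}}) := (L \subset S) && connect (adj S) p q.
have PT : P T by rewrite /P LT Tc.
have [S /minsetP[/andP[LS Spq] Smin] ST] := minset_exists PT.
have /subsetPn[e eS eL] : ~~ (S \subset L).
  by apply: contra nL => SL; exact: connect_adjS Spq.
have eT : e \in T by exact: (fintype.subsetP ST).
exists e; split=> //; apply/negP => Tpq.
have nS : ~~ connect (adj (S :\ e)%SET) p q.
  apply/negP => Se.
  have : (S :\ e)%SET = S.
    apply: Smin; last exact: finset.subD1set.
    by rewrite /P Se subsetD1 LS eL.
  by move=> /setP/(_ e); rewrite in_setD1 eqxx eS.
have /cards2P[a [b [_ eE]]] := Te _ eT.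
have abT : [set a; b]%SET \in T by rewrite -eE.
have /negP := Ta _ _ abT; rewrite -eE; apply.
have sST : (S :\ e \subset T :\ e)%SET by exact: finset.setSD.
move: Spq; rewrite -{1}(finset.setD1K eS) {1}eE => /connect_adjU1[|[pa bq]|[pb aq]].
- by rewrite (negbTE nS).
- have pa' := connect_adjS sST pa; have bq' := connect_adjS sST bq.
  rewrite connect_adjC in pa'; rewrite connect_adjC in bq'.
  exact: connect_trans pa' (connect_trans Tpq bq').
- have pb' := connect_adjS sST pb; have aq' := connect_adjS sST aq.
  rewrite connect_adjC in Tpq.
  exact: connect_trans aq' (connect_trans Tpq pb').
Qed.

(** Otherwise some edge separating [p] from [q] in [T] is dearer than [pq], and exchanging it for
    [pq] makes the tree cheaper. *)
Lemma min_spanning_tree_bottleneck (R : realType) (O : finType)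
    (c : {set O} -> R) (T : {set {set O}}) :
  min_spanning_tree c T -> bottleneck c T.
Proof.
move=> [Tt Tmin] p q pq; apply/negPn/negP => nL.
have LT : ([set e in T | c e <= c [set p; q]] \subset T)%SET.
  by apply/fintype.subsetP => e; rewrite inE => /andP[].
have [e [eT eL npq]] := exists_separating_edge Tt LT nL.
have := Tmin _ (spanning_tree_exchange Tt eT npq).
rewrite cost_exchange //; last by apply: contra npq => ?; exact: connect1.
rewrite -addrA lerDl subr_ge0 => ce.
by move: eL; rewrite inE eT ce.
Qed.

(** Induction on the number of edges of [T'] outside [T]: such an edge is exchanged for one of [T]
    that costs no more. When none is left, [T'] equals [T], since any further edge of [T] would fail
    to be a bridge. *)
Lemma bottleneck_min_spanning_tree (R : realType) (O : finType)
    (c : {set O} -> R) (T : {set {set O}}) :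
  is_spanning_tree T -> bottleneck c T -> min_spanning_tree c T.
Proof.
move=> Tt Tb; split=> // T'.
have [n] := ubnP #|T' :\: T|%SET; elim: n T' => // n IH T' ltn Tt'.
have /spanning_treeP[Te' Tc' Ta'] := Tt'; have /spanning_treeP[Te Tc Ta] := Tt.
have [T'T|] := boolP (T' \subset T).
  suff -> : T' = T by [].
  apply/eqP; rewrite finset.eqEsubset T'T /=; apply/fintype.subsetP => e eT.
  have /cards2P[a [b [_ eE]]] := Te _ eT.
  apply/negPn/negP => eT'; rewrite eE in eT.
  have /negP[] := Ta _ _ eT; apply: connect_adjS (Tc' a b).
  by rewrite subsetD1 T'T -eE.
move=> /subsetPn[f fT' fT].
have /cards2P[p [q [pq fE]]] := Te' _ fT'.
have pqT' : [set p; q]%SET \in T' by rewrite -fE.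
have := Ta' _ _ pqT'; rewrite -fE => npq.
(* The light path of [T] joining the endpoints of [f] crosses the cut defined
   by [f] in [T']. *)
have [a [b [abT abf nab]]] : exists a b, [/\ [set a; b]%SET \in T,
    c [set a; b]%SET <= c f & ~~ connect (adj (T' :\ f)%SET) a b].
  have /connectP[s] := Tb _ _ pq; rewrite -fE.
  elim: s p {pq fE pqT'} npq => [|z s IHs] p npq /=.
    by move=> _ qp; rewrite qp connect0 in npq.
  case/andP; rewrite {1}/adj inE => /andP[pzT pzf] zs qE.
  have [pz|npz] := boolP (connect (adj (T' :\ f)%SET) p z); last by exists p, z.
  apply: (IHs z) => //; apply: contra npq; exact: connect_trans.
set e := [set a; b]%SET in abT abf.
have eT' : e \notin (T' :\ f)%SET by apply: contra nab => ?; exact: connect1.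
apply: le_trans (IH _ _ (spanning_tree_exchange Tt' fT' nab)) _.
  move: ltn; rewrite ltnS; apply: leq_trans; apply: proper_card.
  apply/fintype.properP; split.
    apply/fintype.subsetP => h; rewrite !inE => /andP[hT /orP[/eqP hE|/andP[_ ->]]].
      by rewrite hE -/e abT in hT.
    by rewrite hT.
  exists f; first by rewrite !inE fT fT'.
  rewrite !inE eqxx fT /= orbF; apply: contra fT => /eqP ->; exact: abT.
by rewrite cost_exchange // -addrA gerDl subr_le0.
Qed.

Lemma min_spanning_tree_exists (R : realType) (O : finType) (c : {set O} -> R) :
  exists T, min_spanning_tree c T.
Proof.
have [T0 T0t] := spanning_tree_exists O.
have T0t' : `[< is_spanning_tree T0 >] by apply/asboolP.
case: (@arg_minP _ R _ T0 (fun T => `[< is_spanning_tree T >]) (cost c) T0t').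
move=> T /asboolP Tt Tmin; exists T; split=> // T' T't.
by apply: Tmin; apply/asboolP.
Qed.

Lemma connect_bottleneck (R : realType) (O : finType) (c : {set O} -> R)
    (T : {set {set O}}) (D : rel O) (r : R) (p q : O) :
  bottleneck c T ->
  (forall a b, D a b -> a != b -> c [set a; b]%SET <= r) ->
  connect D p q -> connect (adj [set e in T | c e <= r]%SET) p q.
Proof.
move=> Tb Dr; apply: connect_sub => a b Dab.
case: (eqVneq a b) => [->//|ab]; apply: connect_adjS (Tb _ _ ab).
apply/fintype.subsetP => e; rewrite !inE => /andP[-> /le_trans]; apply; exact: Dr.
Qed.

(** * Ultra-metrics along paths, and comparison of structures *)

Lemma ultrametric_connect_le (R : realType) (O : finType) (u : O -> O -> R)
    (D : rel O) (r : R) (p q : O) :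
  is_ultrametric u -> 0 <= r -> (forall a b, D a b -> u a b <= r) ->
  connect D p q -> u p q <= r.
Proof.
move=> [[_ u0 _] ut] r0 Dr /connectP[s]; elim: s p => [|z s IH] p /=.
  by move=> _ ->; rewrite u0.
case/andP=> pz zs qE; apply: le_trans (ut p z q) _.
by rewrite ge_max Dr // IH.
Qed.

Lemma ultrametric_connect_lt (R : realType) (O : finType) (u : O -> O -> R)
    (D : rel O) (r : R) (p q : O) :
  is_ultrametric u -> 0 < r -> (forall a b, D a b -> u a b < r) ->
  connect D p q -> u p q < r.
Proof.
move=> [[_ u0 _] ut] r0 Dr /connectP[s]; elim: s p => [|z s IH] p /=.
  by move=> _ ->; rewrite u0.
case/andP=> pz zs qE; apply: le_lt_trans (ut p z q) _.
by rewrite gt_max Dr // IH.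
Qed.

(** As both order pairs alike, the pairs with [u] at most [r] are those with [v] at most [r'], the
    largest value of [v] on them. *)
Lemma structure_sub (R : realType) (O : finType) (u v : O -> O -> R) :
  is_weight u -> is_weight v ->
  (forall a b c d, (u a b <= u c d) = (v a b <= v c d)) ->
  (structure u `<=` structure v)%classic.
Proof.
move=> [_ u0 _] [_ v0 v_ge0] uv _ [r /= r0 <-].
pose r' : R := \big[Num.max/0]_(p : O * O | u p.1 p.2 <= r) v p.1 p.2.
exists r' => /=; first exact: bigmax_ge_id.
rewrite /beta; apply: eq_imset => p; apply/setP => q; rewrite !inE.
apply/idP/idP => [vr|ur]; last exact: (@bigmax_sup _ _ _ _ (p, q)).
apply: contraTT vr; rewrite -!ltNge => ur.
rewrite /r'; apply: bigmax_lt => [|[a b] /= abr].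
  (* The default 0 of the maximum is the value of [v] on the diagonal, hence also below [v p q]. *)
  by rewrite -(v0 p) ltNge -uv u0 -ltNge (le_lt_trans r0).
by rewrite ltNge -uv -ltNge (le_lt_trans abr).
Qed.

(** * Single linkage, read off a minimum spanning tree *)

Section SingleLinkage.
Variables (R : realType) (O : finType) (d : O -> O -> R).
Hypothesis dw : is_weight d.

Lemma sl_connect p q : connect (fun a b => d a b <= sl d p q) p q.
Proof. by have [[_ [s sP qE]] _] := sl_least p q dw; apply/connectP; exists s. Qed.

Lemma sl_le p q r :
  0 <= r -> connect (fun a b => d a b <= r) p q -> sl d p q <= r.
Proof.
move=> r0 /connectP[s sP qE]; have [_] := sl_least p q dw; apply.
by split=> //; exists s.
Qed.

Lemma sl_ge0 p q : 0 <= sl d p q.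
Proof. by have [[]] := sl_least p q dw. Qed.

Lemma sl_le_weight p q : sl d p q <= d p q.
Proof. by apply: sl_le; [case: dw|apply: connect1]. Qed.

Lemma sl_ultrametric : is_ultrametric (sl d).
Proof.
have [dC d0 _] := dw; split; first split.
- suff le p q : sl d q p <= sl d p q by move=> p q; apply/eqP; rewrite eq_le !le.
  apply: sl_le; first exact: sl_ge0.
  rewrite sym_connect_sym; first exact: sl_connect.
  by move=> a b; rewrite dC.
- by move=> p; apply/eqP; rewrite eq_le sl_ge0 sl_le.
- exact: sl_ge0.
move=> p q s; apply: sl_le; first by rewrite le_max sl_ge0.
apply: (@connect_trans _ _ q).
  apply: connect_sub (sl_connect p q) => a b ab.
  by apply: connect1; rewrite le_max ab.
apply: connect_sub (sl_connect q s) => a b ab.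
by apply: connect1; rewrite le_max ab orbT.
Qed.

(** The least level is attained, so level 0 comes with a chain of steps of length 0, all trivial for
    strict [d]. *)
Lemma sl_strict : is_strict d -> is_strict (sl d).
Proof.
move=> ds p q pq; rewrite lt_def sl_ge0 andbT; apply: contraNneq pq => sl0.
have /connectP[s] := sl_connect p q; rewrite sl0.
elim: s p {sl0} => [|z s IH] p /=; first by move=> _ ->.
case/andP=> pz zs qE; case: (eqVneq p z) => [->|/ds]; first exact: IH.
by rewrite ltNge pz.
Qed.

Variable T : {set {set O}}.
Hypotheses (Tt : is_spanning_tree T) (Tb : bottleneck (edge_weight d) T).

Lemma sl_connect_tree p q :
  connect (adj [set e in T | edge_weight d e <= sl d p q]%SET) p q.
Proof.
apply: connect_bottleneck Tb _ (sl_connect p q) => a b ab anb.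
by rewrite edge_weight_set2.
Qed.

(** If [sl d a b] were below [d a b], tree edges other than [ab] would join [a] to [b], but [ab] is
    a bridge. *)
Lemma sl_tree_edge a b : [set a; b]%SET \in T -> sl d a b = d a b.
Proof.
have /spanning_treeP[Te _ Ta] := Tt => abT.
have ab : a != b by rewrite -is_edge_set2 Te.
apply/eqP; rewrite eq_le sl_le_weight /= leNgt; apply/negP => lt.
have /negP[] := Ta _ _ abT; apply: connect_adjS (sl_connect_tree a b).
rewrite subsetD1; apply/andP; split.
  by apply/fintype.subsetP => e; rewrite inE => /andP[].
by rewrite inE abT /= edge_weight_set2 // -ltNge.
Qed.

End SingleLinkage.

(** * Comparison of edge costs and of products *)

Lemma edge_weight_gt0 (R : realType) (O : finType) (d : O -> O -> R) e :
  is_weight d -> is_strict d -> is_edge e -> 0 < edge_weight d e.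
Proof.
by move=> dw ds /cards2P[p [q [pq ->]]]; rewrite edge_weight_set2 // ds.
Qed.

Lemma bottleneck_homo (R : realType) (O : finType) (c c' : {set O} -> R)
    (T : {set {set O}}) :
  (forall e, e \in T -> is_edge e) ->
  (forall e f, is_edge e -> is_edge f -> c e <= c f -> c' e <= c' f) ->
  bottleneck c T -> bottleneck c' T.
Proof.
move=> Te cc' Tb p q pq; apply: connect_adjS (Tb _ _ pq).
apply/fintype.subsetP => e; rewrite !inE => /andP[eT ce]; rewrite eT /=.
by apply: cc' ce; rewrite ?is_edge_set2 ?Te.
Qed.

(** A single factor strictly below its bound makes the whole product strictly smaller, because the
    other bounds have a positive product. *)
Lemma ler_prod_eq_factors (R : realFieldType) (I : finType) (A : {set I}) (E F : I -> R) :
  (forall i, i \in A -> 0 <= E i <= F i) -> (forall i, i \in A -> 0 < F i) ->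
  \prod_(i in A) F i <= \prod_(i in A) E i -> {in A, E =1 F}.
Proof.
move=> EF F0 le i iA; have /andP[E0 Ei] := EF i iA.
apply/eqP; move: Ei; rewrite le_eqVlt => /orP[//|lt].
move: le; rewrite leNgt (big_setD1 i) //= [ltRHS](big_setD1 i) //=.
suff -> : E i * \prod_(j in (A :\ i)%SET) E j < F i * \prod_(j in (A :\ i)%SET) F j.
  by [].
apply: (@le_lt_trans _ _ (E i * \prod_(j in (A :\ i)%SET) F j)).
  by rewrite ler_wpM2l // ler_prod // => j /setD1P[_ /EF].
by rewrite ltr_pM2r // prodr_gt0 // => j /setD1P[_ /F0].
Qed.

(** * The partial profile likelihood and its maximizer *)

Section ProfileLikelihood.
Variables (R : realType) (O : finType) (G : R -> R -> R) (thetahat : R -> R).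
Variable x : O -> O -> R.
Hypothesis hG : forall theta t, 0 < theta -> 0 < t -> 0 <= G theta t.
Hypothesis hmle : forall t, 0 < t -> unique (is_mle G t) (thetahat t).
Hypothesis hinc : forall s t, 0 < s -> s < t -> thetahat s < thetahat t.
Hypothesis hdec :
  forall s t, 0 < s -> s < t -> G (thetahat t) t < G (thetahat s) s.
Hypotheses (hx : is_weight x) (hxs : is_strict x).

Let g t := G (thetahat t) t.

Let c e := - ln (g (edge_weight x e)).

Let xe_gt0 e : is_edge e -> 0 < edge_weight x e.
Proof. exact: edge_weight_gt0. Qed.

Lemma mle_gt0 t : 0 < t -> 0 < thetahat t.
Proof. by case/hmle => -[]. Qed.

Lemma mle_le s t : 0 < s -> 0 < t -> (thetahat s <= thetahat t) = (s <= t).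
Proof.
move=> s0 t0; case: (ltgtP s t) => [st|ts|->]; last by rewrite lexx.
  by rewrite ltW // hinc.
by apply/negbTE; rewrite -ltNge hinc.
Qed.

(** Densities are only nonnegative; positivity comes from strict decrease, as [g t] exceeds
    [g (t + 1)]. *)
Lemma max_likelihood_gt0 t : 0 < t -> 0 < g t.
Proof.
move=> t0; have t1 : t < t + 1 by rewrite ltrDl.
apply: le_lt_trans (hdec t0 t1); have t10 := lt_trans t0 t1.
by rewrite hG // mle_gt0.
Qed.

Lemma max_likelihood_le s t : 0 < s -> 0 < t -> (g t <= g s) = (s <= t).
Proof.
move=> s0 t0; case: (ltgtP s t) => [st|ts|->]; last by rewrite lexx.
  by rewrite ltW // /g hdec.
by apply/negbTE; rewrite -ltNge /g hdec.
Qed.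

Lemma max_tree_likelihoodE T : is_spanning_tree T ->
  \prod_(e in T) g (edge_weight x e) = expR (- cost c T).
Proof.
move=> [Te _ _]; rewrite /cost sumrN opprK expR_sum.
by apply: eq_bigr => e /Te/xe_gt0/max_likelihood_gt0 ge; rewrite lnK.
Qed.

Lemma cost_edge_le e f : is_edge e -> is_edge f ->
  (c e <= c f) = (edge_weight x e <= edge_weight x f).
Proof.
move=> /xe_gt0 e0 /xe_gt0 f0.
by rewrite /c lerN2 ler_ln ?posrE ?max_likelihood_gt0 // max_likelihood_le.
Qed.

Lemma cost_bottleneck T : is_spanning_tree T -> bottleneck c T ->
  bottleneck (edge_weight x) T.
Proof.
move=> [Te _ _]; apply: bottleneck_homo => // e f ee fe.
by rewrite cost_edge_le.
Qed.

Lemma likelihood_bounds u e : is_weight u -> is_strict u -> is_edge e ->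
  0 <= G (edge_weight u e) (edge_weight x e) <= g (edge_weight x e).
Proof.
move=> uw us ee; have x0 := xe_gt0 ee; have u0 := edge_weight_gt0 uw us ee.
by rewrite hG //=; have [[_ ->]] := hmle x0.
Qed.

Lemma pp_likelihood_le u M : is_weight u -> is_strict u -> min_spanning_tree c M ->
  pp_likelihood G u x <= expR (- cost c M).
Proof.
move=> uw us [_ Mmin]; apply: bigmax_le; first exact: expR_ge0.
move=> T /asboolP[Tt _]; have [Te _ _] := Tt.
apply: (@le_trans _ _ (\prod_(e in T) g (edge_weight x e))).
  by apply: ler_prod => e /Te; exact: likelihood_bounds.
by rewrite max_tree_likelihoodE // ler_expR lerN2 Mmin.
Qed.

(* The diagonal is set apart because [thetahat 0] is unconstrained. *)
Definition mle_sl (p q : O) : R := if p == q then 0 else thetahat (sl x p q).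

(** Monotonicity of [thetahat] off the diagonal, positivity against it. This yields both the
    ultra-metric inequality for [mle_sl] and the equality of structures. *)
Lemma sl_mle_sl_le a b p q :
  (sl x a b <= sl x p q) = (mle_sl a b <= mle_sl p q).
Proof.
have [[_ sl0 slge0] _] := sl_ultrametric hx; have slgt0 := sl_strict hx hxs.
rewrite /mle_sl; case: (eqVneq a b) => [->|ab]; case: (eqVneq p q) => [->|pq].
- by rewrite !sl0 lexx.
- by rewrite sl0 slge0 ltW // mle_gt0 // slgt0.
- by rewrite sl0 !leNgt mle_gt0 !slgt0.
- by rewrite mle_le ?slgt0.
Qed.

Lemma mle_sl_ultrametric : is_ultrametric mle_sl.
Proof.
have [[slC sl0 slge0] slt] := sl_ultrametric hx.
have m0 p : mle_sl p p = 0 by rewrite /mle_sl eqxx.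
split; first split=> //.
- by move=> p q; rewrite /mle_sl eq_sym slC.
- by move=> p q; rewrite -(m0 p) -sl_mle_sl_le sl0 slge0.
by move=> p q r; have := slt p q r; rewrite !le_max !sl_mle_sl_le.
Qed.

Lemma mle_sl_strict : is_strict mle_sl.
Proof. by move=> p q pq; rewrite /mle_sl (negbTE pq) mle_gt0 // sl_strict. Qed.

(** Single linkage agrees with [x] on the edges of [M], so each factor over [M] is maximal and the
    upper bound is attained. *)
Lemma pp_likelihood_mle_sl M : min_spanning_tree c M ->
  pp_likelihood G mle_sl x = expR (- cost c M).
Proof.
move=> Mmin; have Mt := Mmin.1; have [Me Mc _] := Mt.
have [mw mt] := mle_sl_ultrametric; have ms := mle_sl_strict.
apply/eqP; rewrite eq_le pp_likelihood_le //=.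
have Mb := cost_bottleneck Mt (min_spanning_tree_bottleneck Mmin).
have uM e : e \in M -> edge_weight mle_sl e = thetahat (edge_weight x e).
  move=> eM; have /cards2P[a [b [ab eE]]] := Me _ eM; rewrite eE in eM *.
  rewrite !edge_weight_set2 // /mle_sl (negbTE ab).
  by rewrite (sl_tree_edge hx Mt Mb eM).
rewrite -max_tree_likelihoodE //; apply: (@bigmax_sup _ _ _ _ M).
  (* [M] must be a minimum spanning tree of [mle_sl] to enter the maximum: it joins [p] to [q] by
     edges with [x] at most [sl x p q], and [thetahat] preserves this bound. *)
  apply/asboolP; apply: bottleneck_min_spanning_tree => // p q pq.
  apply: connect_adjS (sl_connect_tree hx Mb p q).
  apply/fintype.subsetP => e; rewrite !inE => /andP[eM le].
  rewrite eM uM // edge_weight_set2 // /mle_sl (negbTE pq) mle_le //.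
    by apply: xe_gt0; exact: Me.
  by rewrite sl_strict.
by rewrite le_eqVlt; apply/orP; left; apply/eqP/eq_bigr => e eM; rewrite uM.
Qed.

(** Paths in [T] control both sides: the path that is light for [x] bounds [u p q] from above, the
    one that is light for [u] bounds [sl x p q]. *)
Lemma tree_determines_mle_sl u T : is_ultrametric u -> is_spanning_tree T ->
  bottleneck (edge_weight x) T -> bottleneck (edge_weight u) T ->
  (forall e, e \in T -> edge_weight u e = thetahat (edge_weight x e)) ->
  u = mle_sl.
Proof.
move=> uu [Te _ _] Txb Tub uT; have [[uC u0 uge0] _] := uu.
have us := sl_ultrametric hx; have uw := uu.1.
apply/funext => p; apply/funext => q; rewrite /mle_sl.
case: eqVneq => [->//|pq]; have slpq := sl_strict hx hxs pq.
have adjP (F : {set {set O}}) a b : F \subset T -> adj F a b ->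
    [/\ a != b, 0 < x a b & u a b = thetahat (x a b)].
  move=> /fintype.subsetP sF /sF abT; have := Te _ abT.
  rewrite is_edge_set2 => ab; split=> //; first exact: hxs.
  by have := uT _ abT; rewrite !edge_weight_set2.
apply/eqP; rewrite eq_le; apply/andP; split.
  apply: (ultrametric_connect_le uu (ltW (mle_gt0 slpq)) _
    (sl_connect_tree hx Txb p q)) => a b ab.
  have [|anb x0 ->] := adjP _ _ _ _ ab.
    by apply/fintype.subsetP => e; rewrite inE => /andP[].
  move: ab; rewrite /adj inE => /andP[_].
  by rewrite edge_weight_set2 // mle_le.
(* Were [u p q] below [thetahat (sl x p q)], the tree path with [u] at most [u p q] would have all
   its [x] values below [sl x p q], so single linkage would lie below itself. *)
rewrite leNgt; apply/negP => lt.
suff : sl x p q < sl x p q by rewrite ltxx.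
apply: (ultrametric_connect_lt us slpq _ (Tub _ _ pq)) => a b ab.
have [|anb x0 uE] := adjP _ _ _ _ ab.
  by apply/fintype.subsetP => e; rewrite inE => /andP[].
apply: le_lt_trans (sl_le_weight hx a b) _.
move: ab; rewrite /adj inE => /andP[_].
rewrite !edge_weight_set2 // uE => /le_lt_trans/(_ lt).
by rewrite !ltNge mle_le.
Qed.

Lemma pp_likelihood_eq_max u M : is_ultrametric u -> is_strict u ->
  min_spanning_tree c M -> expR (- cost c M) <= pp_likelihood G u x ->
  u = mle_sl.
Proof.
move=> uu us [Mt Mmin] le; have uw := uu.1.
(* The bound is positive, so the iterated maximum is not its default 0 and some tree reaches the
   bound. *)
have [T [Tu lT]] : exists T, MST u T /\
    expR (- cost c M) <= \prod_(e in T) G (edge_weight u e) (edge_weight x e).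
  apply: contrapT => noT; move: le; rewrite leNgt => /negP; apply.
  apply: bigmax_lt; first exact: expR_gt0.
  move=> T /asboolP Tu; rewrite ltNge; apply/negP => lT.
  by apply: noT; exists T.
have Tt : is_spanning_tree T := Tu.1; have [Te _ _] := Tt.
have bnd e : e \in T -> 0 <= G (edge_weight u e) (edge_weight x e)
    <= g (edge_weight x e) by move=> /Te; exact: likelihood_bounds.
have lg : cost c T <= cost c M.
  rewrite -lerN2 -ler_expR -(max_tree_likelihoodE Tt).
  by apply: le_trans lT _; apply: ler_prod => e; exact: bnd.
have Tmin : min_spanning_tree c T.
  by split=> // T' /Mmin; exact: le_trans lg.
apply: (@tree_determines_mle_sl _ T) => //.
- exact: cost_bottleneck (min_spanning_tree_bottleneck Tmin).
- exact: (min_spanning_tree_bottleneck Tu).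
move=> e eT; have x0 := xe_gt0 (Te _ eT); have [mle mleU] := hmle x0.
(* Equality of the products forces equality of the factors, so the value of [u] on [e] is a maximum
   likelihood estimate; uniqueness identifies it. *)
apply/esym/mleU; split; first exact: edge_weight_gt0 (Te _ eT).
move=> theta theta0.
rewrite (@ler_prod_eq_factors _ _ T (fun e => G (edge_weight u e) (edge_weight x e))
  (fun e => g (edge_weight x e)) bnd) //; first exact: mle.2.
  by move=> f /Te/xe_gt0; exact: max_likelihood_gt0.
by rewrite max_tree_likelihoodE //; apply: le_trans lT; rewrite ler_expR lerN2 Mmin.
Qed.

Lemma mppleP u : is_mpple G x u <-> u = mle_sl.
Proof.
have [M Mmin] := min_spanning_tree_exists c.
have [[mw mt] ms] := (mle_sl_ultrametric, mle_sl_strict).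
split=> [[uu us umax]|->].
  apply: (pp_likelihood_eq_max uu us Mmin).
  by rewrite -pp_likelihood_mle_sl // umax.
split=> // v [vw _] vs; rewrite (pp_likelihood_mle_sl Mmin).
exact: pp_likelihood_le.
Qed.

Lemma structure_mle_sl : structure (sl x) = structure mle_sl.
Proof.
have [sw _] := sl_ultrametric hx; have [mw _] := mle_sl_ultrametric.
by apply/seteqP; split; apply: structure_sub => // a b p q; rewrite sl_mle_sl_le.
Qed.

Lemma mle_sl_id : (forall t, 0 < t -> thetahat t = t) -> sl x = mle_sl.
Proof.
have [[_ sl0 _] _] := sl_ultrametric hx.
move=> idt; apply/funext => p; apply/funext => q; rewrite /mle_sl.
by case: eqVneq => [->|pq]; rewrite ?sl0 // idt // sl_strict.
Qed.

End ProfileLikelihood.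

Theorem theorem3p3 (R : realType) (O : finType) (hO : (1 < #|O|)%N)
    (G : R -> R -> R)
    (hG : forall theta, 0 < theta -> is_density (G theta))
    (thetahat : R -> R)
    (hmle : forall t, 0 < t -> unique (is_mle G t) (thetahat t))
    (x : O -> O -> R) (hx : is_weight x) (hxs : is_strict x)
    (hinc : forall s t, 0 < s -> s < t -> thetahat s < thetahat t)
    (hdec : forall s t, 0 < s -> s < t -> G (thetahat t) t < G (thetahat s) s) :
  (exists! uhat : O -> O -> R, is_mpple G x uhat) /\
  forall uhat : O -> O -> R, is_mpple G x uhat ->
    structure (sl x) = structure uhat /\
    ((forall t, 0 < t -> thetahat t = t) -> sl x = uhat).
Proof.
have G0 theta t : 0 < theta -> 0 < t -> 0 <= G theta t.
  by move=> /hG[_ Gt _]; exact: Gt.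
have P := mppleP G0 hmle hinc hdec hx hxs.
split.
  by exists (mle_sl thetahat x); split=> [|v /P ->//]; apply/P.
move=> u /P ->; split; first exact: (structure_mle_sl hmle hinc hx hxs).
exact: mle_sl_id.
Qed.
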